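(* Let $P\subset N_{\mathbb{Q}}$ be a lattice polytope, and let $\mathrm{mut}_w(P,F)$ be a combinatorial mutation of $P$. Then $\mathrm{mut}_w(P,F)$ is a Fano polytope if and only if $P$ is a Fano polytope.
   Context: $N$ is a lattice of rank $n$, $N_{\mathbb{Q}}=N\otimes\mathbb{Q}$, $M=\mathrm{Hom}(N,\mathbb{Z})$. Polytopes are convex; a lattice polytope has vertices in $N$; $\mathcal{V}(P)$ denotes the vertex set of $P$. Fano: a lattice polytope $P\subset N_{\mathbb{Q}}$ is Fano if $\dim P=n$, the origin lies in the strict interior of $P$, and all vertices of $P$ are primitive lattice points of $N$. Combinatorial mutation: let $w\in M$ be a primitive lattice vector and $P\subset N_{\mathbb{Q}}$ a lattice polytope. Set $h_{\min}=\min\{w(v)\mid v\in P\}$, $h_{\max}=\max\{w(v)\mid v\in P\}$. For $h\in\mathbb{Z}$ let $H_{w,h}=\{x\in N_{\mathbb{Q}}\mid w(x)=h\}$ and $w_h(P)=\mathrm{conv}(H_{w,h}\cap P\cap N)$. Minkowski sum is $Q+R=\{q+r\mid q\in Q,r\in R\}$, with the convention $Q+\varnothing=\varnothing$. A (nonempty) lattice polytope $F\subset N_{\mathbb{Q}}$ with $w(F)=0$ is called a factor for $P$ with respect to $w$ if for every integer $h_{\min}\le h<0$ there exists a possibly empty lattice polytope $G_h\subset N_{\mathbb{Q}}$ with $$H_{w,h}\cap\mathcal{V}(P)\subseteq G_h+(-h)F\subseteq w_h(P).$$ Given such $w$, $F$, $\{G_h\}$, the combinatorial mutation is the lattice polytope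 $$\mathrm{mut}_w(P,F;\{G_h\})=\mathrm{conv}\left(\bigcup_{h=h_{\min}}^{-1}G_h\cup\bigcup_{h=0}^{h_{\max}}(w_h(P)+hF)\right).$$ This is independent of the choice of $\{G_h\}$, and is written $\mathrm{mut}_w(P,F)$. *)

(* Defs.v *)
From HB Require Import structures.
From mathcomp Require Import all_boot all_order all_algebra.
From mathcomp Require Import boolp classical_sets topology normedtype convex.

Set Implicit Arguments.
Unset Strict Implicit.
Unset Printing Implicit Defensive.

Import Order.TTheory GRing.Theory Num.Theory numFieldNormedType.Exports.
Local Open Scope classical_set_scope.
Local Open Scope ring_scope.

(* A basis of N is fixed: N = 'rV[int]_n, N_Q = 'rV[rat]_n, and the dual
   lattice M = Hom(N, Z) is 'cV[int]_n, acting by the matrix product. *)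

Definition embed (n : nat) (z : 'rV[int]_n) : 'rV[rat]_n := map_mx intr z.

Definition lattice (n : nat) : set 'rV[rat]_n := range (@embed n).

(* Zero is not primitive, since 0 = 0 *+ 2. *)
Definition primitive (V : zmodType) (v : V) : Prop :=
  forall (u : V) (k : nat), v = u *+ k -> k = 1%N.

Definition primitive_point (n : nat) (x : 'rV[rat]_n) : Prop :=
  exists2 z : 'rV[int]_n, x = embed z & primitive z.

Definition convex_hull (n : nat) (A : set 'rV[rat]_n) : set 'rV[rat]_n :=
  smallest (@convex_set rat 'rV[rat]_n) A.

(* Vertices are the extreme points. *)
Definition vertices (n : nat) (P : set 'rV[rat]_n) : set 'rV[rat]_n :=
  [set v | P v /\ forall (x y : 'rV[rat]_n) (t : rat), P x -> P y ->
     0 < t -> t < 1 -> v = t *: x + (1 - t) *: y -> x = v /\ y = v].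

(* The empty set is a polytope. *)
Definition polytope (n : nat) (P : set 'rV[rat]_n) : Prop :=
  exists s : seq 'rV[rat]_n, P = convex_hull [set` s].

Definition lattice_polytope (n : nat) (P : set 'rV[rat]_n) : Prop :=
  polytope P /\ vertices P `<=` @lattice n.

Definition contains_directions (n : nat) (P : set 'rV[rat]_n)
    (U : {vspace 'rV[rat]_n}) : Prop :=
  forall x y, P x -> P y -> x - y \in U.

(* U is the direction space of the affine hull of P. *)
Definition has_dim (n : nat) (P : set 'rV[rat]_n) (d : nat) : Prop :=
  P !=set0 /\ exists U : {vspace 'rV[rat]_n},
    [/\ contains_directions P U,
        forall U' : {vspace 'rV[rat]_n},
          contains_directions P U' -> (U <= U')%VS
      & \dim U = d].

Definition fano (n : nat) (P : set 'rV[rat]_n) : Prop :=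
  [/\ lattice_polytope P, has_dim P n, interior (P : set 'rV[rat^o]_n) 0
    & vertices P `<=` @primitive_point n].

Definition height (n : nat) (w : 'cV[int]_n) (x : 'rV[rat]_n) : rat :=
  (x *m map_mx intr w) 0 0.

(* The default value 0 is only reached when the extremum does not exist; for a
   polytope P this means that P is empty. *)
Definition hmin (n : nat) (w : 'cV[int]_n) (P : set 'rV[rat]_n) : rat :=
  xget 0 [set m | (height w @` P) m /\ lbound (height w @` P) m].

Definition hmax (n : nat) (w : 'cV[int]_n) (P : set 'rV[rat]_n) : rat :=
  xget 0 [set m | (height w @` P) m /\ ubound (height w @` P) m].

Definition hyperplane (n : nat) (w : 'cV[int]_n) (h : int) :
    set 'rV[rat]_n :=
  [set x | height w x = h%:~R].

Definition slice (n : nat) (w : 'cV[int]_n) (P : set 'rV[rat]_n) (h : int) :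
    set 'rV[rat]_n :=
  convex_hull (hyperplane w h `&` P `&` @lattice n).

Definition minkowski_sum (n : nat) (A B : set 'rV[rat]_n) : set 'rV[rat]_n :=
  [set x + y | x in A & y in B].

Definition dilate (n : nat) (c : int) (A : set 'rV[rat]_n) :
    set 'rV[rat]_n :=
  [set c%:~R *: x | x in A].

(* Only the values of G at integers h with hmin <= h < 0 matter. *)
Definition mutation_data (n : nat) (w : 'cV[int]_n) (P F : set 'rV[rat]_n)
    (G : int -> set 'rV[rat]_n) : Prop :=
  forall h : int, hmin w P <= h%:~R -> h < 0 ->
    [/\ lattice_polytope (G h),
        hyperplane w h `&` vertices P `<=` minkowski_sum (G h) (dilate (- h) F)
      & minkowski_sum (G h) (dilate (- h) F) `<=` slice w P h].

Definition is_factor (n : nat) (w : 'cV[int]_n) (P F : set 'rV[rat]_n) : Prop :=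
  [/\ lattice_polytope F, F !=set0, F `<=` hyperplane w 0
    & exists G : int -> set 'rV[rat]_n, mutation_data w P F G].

Definition mutation (n : nat) (w : 'cV[int]_n) (P F : set 'rV[rat]_n)
    (G : int -> set 'rV[rat]_n) : set 'rV[rat]_n :=
  convex_hull (\bigcup_(h in [set h : int | hmin w P <= h%:~R /\ h < 0]) G h
    `|` \bigcup_(h in [set h : int | 0 <= h /\ h%:~R <= hmax w P])
          minkowski_sum (slice w P h) (dilate h F)).

(* Main.v *)
(* Let T(u) = u + (max_F u) w. Every vertex v of P has an f in F such that
   v + w(v) f lies in the mutation Q and u(v + w(v) f) >= T(u)(v): if w(v) >= 0
   every such point is in Q, so take f maximizing u on F, and if w(v) < 0 the
   inequality holds for every f. Generators of Q are related to P in the same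
   way, with -w in place of w, and the T for -w is inverse to the T for w.
   Hence no u separates a generator of Q from the points v + w(v) f of Q with v
   a vertex of P and f a vertex of F, and Q is the hull of these points; they
   are images of v under unimodular shears, so primitive lattice points when v
   is. The origin is interior to a polytope iff every nonzero u is positive at
   some vertex, and this passes from P to Q because T(u) = 0 only for u = 0. *)
Require Import Defs.
From mathcomp Require Import all_boot all_order all_algebra.
From mathcomp Require Import boolp classical_sets topology normedtype convex.
From mathcomp Require Import interval_inference ring lra.

Set Implicit Arguments.
Unset Strict Implicit.
Unset Printing Implicit Defensive.

Import Order.TTheory GRing.Theory Num.Theory numFieldNormedType.Exports.
Local Open Scope classical_set_scope.
Local Open Scope ring_scope.

(** * Linear functionals on N_Q *)

Definition pairing n (u : 'cV[rat]_n) (x : 'rV[rat]_n) : rat := (x *m u) 0 0.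

Lemma pairingDr n (u : 'cV[rat]_n) x y :
  pairing u (x + y) = pairing u x + pairing u y.
Proof. by rewrite /pairing mulmxDl mxE. Qed.

Lemma pairingZr n (u : 'cV[rat]_n) c x : pairing u (c *: x) = c * pairing u x.
Proof. by rewrite /pairing -scalemxAl mxE. Qed.

Lemma pairingNr n (u : 'cV[rat]_n) x : pairing u (- x) = - pairing u x.
Proof. by rewrite /pairing mulNmx mxE. Qed.

Lemma pairingDl n (u v : 'cV[rat]_n) x :
  pairing (u + v) x = pairing u x + pairing v x.
Proof. by rewrite /pairing mulmxDr mxE. Qed.

Lemma pairingZl n (u : 'cV[rat]_n) c x : pairing (c *: u) x = c * pairing u x.
Proof. by rewrite /pairing -scalemxAr mxE. Qed.

Lemma pairingNl n (u : 'cV[rat]_n) x : pairing (- u) x = - pairing u x.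
Proof. by rewrite /pairing mulmxN mxE. Qed.

Definition pairingE :=
  (pairingDr, pairingZr, pairingNr, pairingDl, pairingZl, pairingNl).

Lemma pairing_tr_gt0 n (u : 'cV[rat]_n) : u != 0 -> 0 < pairing u u^T.
Proof.
move=> u0; have sq i : 0 <= u^T 0 i * u i 0 by rewrite mxE -expr2 sqr_ge0.
rewrite /pairing mxE lt0r sumr_ge0 ?andbT//; apply: contra u0 => /eqP.
move=> /(psumr_eq0P (fun i _ => sq i)) u0; apply/eqP/matrixP => i j.
by rewrite ord1 mxE; apply/eqP; have /eqP := u0 i isT; rewrite mxE mulf_eq0 orbb.
Qed.

(** * Convex sets and hulls *)

Lemma convex_setP n (A : set 'rV[rat]_n) :
  convex_set A <-> forall (x y : 'rV[rat]_n) (t : rat), A x -> A y ->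
    0 <= t -> t <= 1 -> A (t *: x + (1 - t) *: y).
Proof.
split=> [cA x y t Ax Ay t0 t1|cA x y t]; last first.
  by rewrite !inE => Ax Ay; apply: cA.
by have := cA x y (Itv01 t0 t1); rewrite !inE; apply.
Qed.

Lemma convex_comb n (A : set 'rV[rat]_n) x y t : convex_set A ->
  A x -> A y -> 0 <= t -> t <= 1 -> A (t *: x + (1 - t) *: y).
Proof. by move=> /convex_setP; apply. Qed.

Lemma hull_convex n (A : set 'rV[rat]_n) : convex_set (convex_hull A).
Proof.
apply/convex_setP => x y t Ax Ay t0 t1 C CA.
by have [/convex_setP CC AC] := CA; apply: CC => //; [exact: Ax|exact: Ay].
Qed.

Lemma sub_hull n (A : set 'rV[rat]_n) : A `<=` convex_hull A.
Proof. exact: sub_gen_smallest. Qed.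

Lemma hull_sub n (A B : set 'rV[rat]_n) :
  convex_set B -> A `<=` B -> convex_hull A `<=` B.
Proof. by move=> cB AB; apply: (@smallest_sub _ (@convex_set rat _)). Qed.

Lemma hull_mono n (A B : set 'rV[rat]_n) :
  A `<=` B -> convex_hull A `<=` convex_hull B.
Proof.
move=> AB; apply: hull_sub; first exact: hull_convex.
exact: subset_trans AB (@sub_hull _ B).
Qed.

Lemma pairing_lt_convex n (u : 'cV[rat]_n) c :
  convex_set [set x | pairing u x < c].
Proof.
apply/convex_setP => x y t /= xc yc t0 t1; rewrite !pairingE.
have [->|t0'] := eqVneq t 0; first lra.
have : 0 < t * (c - pairing u x) by rewrite mulr_gt0 ?subr_gt0 // lt0r t0'.
have : 0 <= (1 - t) * (c - pairing u y) by rewrite mulr_ge0 ?subr_ge0 // ltW.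
lra.
Qed.

Lemma pairing_eq_convex n (u : 'cV[rat]_n) c :
  convex_set [set x | pairing u x = c].
Proof.
apply/convex_setP => x y t /= xc yc t0 t1; rewrite !pairingE xc yc; ring.
Qed.

(** If u were smaller than u(x) on all of A, the open half-space u < u(x) would be a convex set
    containing A, hence x. *)
Lemma hull_le n (u : 'cV[rat]_n) (A : set 'rV[rat]_n) x :
  convex_hull A x -> exists2 a, A a & pairing u x <= pairing u a.
Proof.
move=> Ax; apply/not_exists2P => nA.
suff : [set y | pairing u y < pairing u x] x by rewrite /= ltxx.
apply: hull_sub Ax; first exact: pairing_lt_convex.
move=> a Aa /=.
have [//|/negP] := nA a; by rewrite -ltNge.
Qed.

(** Deleting an extreme point leaves a convex set convex, so an extreme point outside A could be
    deleted from the hull. *)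
Lemma vertices_hull n (A : set 'rV[rat]_n) : vertices (convex_hull A) `<=` A.
Proof.
move=> v [Av ext]; apply: contrapT => nAv.
suff : (convex_hull A `\` [set v]) v by case=> _; apply.
apply: hull_sub Av; last first.
  by move=> a Aa; split; [exact: sub_hull|move=> av; rewrite -av in nAv].
apply/convex_setP => x y t [Ax nx] [Ay ny] t0 t1; split.
  exact: convex_comb (@hull_convex _ A) Ax Ay t0 t1.
move=> /esym /= vE.
have [t0'|t0'] := eqVneq t 0.
  by move: vE; rewrite t0' scale0r add0r subr0 scale1r => /esym.
have [t1'|t1'] := eqVneq t 1.
  by move: vE; rewrite t1' subrr scale0r addr0 scale1r => /esym.
have [|||xv _] := ext x y t Ax Ay; first by rewrite lt0r t0'.
- by rewrite lt_neqAle t1'.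
- done.
by case: nx.
Qed.

(** * Cones, Farkas' lemma and separation *)

Fixpoint in_cone n (s : seq 'rV[rat]_n) (y : 'rV[rat]_n) : Prop :=
  if s is t :: s' then exists2 c, 0 <= c & in_cone s' (y - c *: t) else y = 0.

(** Projecting x along t to the kernel of u adds a nonnegative multiple of t, since u is nonpositive
    at x and positive at t; d collects these multiples. *)
Lemma in_cone_proj n (u : 'cV[rat]_n) (t : 'rV[rat]_n) (s : seq 'rV[rat]_n) z :
  0 < pairing u t -> (forall x, x \in s -> pairing u x <= 0) ->
  in_cone [seq x - (pairing u x / pairing u t) *: t | x <- s] z ->
  exists2 d, 0 <= d & in_cone s (z - d *: t).
Proof.
move=> ut; elim: s z => [|x s IHs] z us /=.
  by move=> ->; exists 0; rewrite // scale0r subr0.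
case=> c c0 /IHs[y ys|d d0 zs]; first by rewrite us // inE ys orbT.
exists (d - c * (pairing u x / pairing u t)).
  have ux : pairing u x <= 0 by rewrite us // mem_head.
  rewrite subr_ge0 (le_trans _ d0) // mulr_ge0_le0 //.
  by rewrite mulr_le0_ge0 // invr_ge0 ltW.
exists c => //; congr (in_cone s _): zs.
apply/rowP => i; rewrite !mxE; ring.
Qed.

(* Bartl's induction: a functional u that separates y from the cone of s either
   works for t :: s, or lets one project everything along t to the kernel of u. *)
Lemma farkas n (s : seq 'rV[rat]_n) (y : 'rV[rat]_n) :
  in_cone s y \/
  exists2 u, forall x, x \in s -> pairing u x <= 0 & 0 < pairing u y.
Proof.
have [m] := ubnP (size s); elim: m s y => // m IHm [|t s] y /= sm.
  have [->|y0] := eqVneq y 0; [by left|right; exists y^T => //].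
  by have := @pairing_tr_gt0 _ y^T; rewrite trmxK; apply; rewrite trmx_eq0.
have [ys|[u us uy]] := IHm s y sm.
  by left; exists 0; rewrite // scale0r subr0.
have [ut|ut] := leP (pairing u t) 0.
  by right; exists u => // x; rewrite inE => /predU1P[-> //|]; apply: us.
pose p x := x - (pairing u x / pairing u t) *: t.
have [|/(in_cone_proj ut us)[d d0 ys]|[v vs vy]] := IHm (map p s) (p y).
- by rewrite size_map.
- left; exists (pairing u y / pairing u t + d).
    by rewrite addr_ge0 // divr_ge0 ?ltW.
  congr (in_cone s _): ys; rewrite /p; apply/rowP => i; rewrite !mxE; ring.
(* This functional is v composed with the projection p, which kills t. *)
have vp x : pairing (v - (pairing v t / pairing u t) *: u) x = pairing v (p x).
  by rewrite /p !pairingE; ring.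
right; exists (v - (pairing v t / pairing u t) *: u); last by rewrite vp.
move=> x; rewrite inE vp => /predU1P[->|xs]; last exact/vs/map_f.
by rewrite /p divff ?gt_eqF // scale1r subrr /pairing mul0mx mxE.
Qed.

(** Dividing by the sum c of the coefficients turns a conic combination into a convex one. *)
Lemma in_cone_hull n (s : seq 'rV[rat]_n) y :
  in_cone s y -> y = 0 \/ exists2 c, 0 < c & convex_hull [set` s] (c^-1 *: y).
Proof.
elim: s y => [|t s IHs] y /=; first by left.
have st : [set` s] `<=` [set` t :: s] by move=> x /= xs; rewrite inE xs orbT.
have tt : convex_hull [set` t :: s] t by apply: sub_hull; rewrite /= mem_head.
case=> c; rewrite le_eqVlt => /predU1P[<-|c0].
  rewrite scale0r subr0 => /IHs[|[d d0 ys]]; [by left|right].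
  by exists d => //; apply: (hull_mono st).
case/IHs => [/eqP|[d d0 /(hull_mono st) ys]].
  rewrite subr_eq0 => /eqP ->; right; exists c => //.
  by rewrite scalerA mulVf ?gt_eqF // scale1r.
right; exists (c + d); first exact: addr_gt0.
have := convex_comb (t := c / (c + d)) (@hull_convex _ [set` t :: s]) tt ys.
have cd0 : c + d != 0 by rewrite gt_eqF ?addr_gt0.
have -> : 1 - c / (c + d) = d / (c + d) by field.
have -> : (c / (c + d)) *: t + (d / (c + d)) *: (d^-1 *: (y - c *: t)) =
   (c + d)^-1 *: y.
  rewrite scalerA mulrAC divff ?gt_eqF // div1r scalerBr scalerA.
  by rewrite mulrC addrCA subrr addr0.
apply; first by rewrite divr_ge0 ?ltW ?addr_gt0.
by rewrite ler_pdivrMr ?addr_gt0 // mul1r lerDl ltW.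
Qed.

(* Homogenization: s and q are lifted to height 1, where the cone of s meets
   exactly the hull of s. *)
Lemma separation n (s : seq 'rV[rat]_n) (q : 'rV[rat]_n) :
  ~ convex_hull [set` s] q ->
  exists u, forall x, x \in s -> pairing u x < pairing u q.
Proof.
move=> nq; pose lift (x : 'rV[rat]_n) : 'rV[rat]_(n + 1) := row_mx x 1%:M.
have [/in_cone_hull[]|[u us uq]] := farkas (map lift s) (lift q).
- move=> /(congr1 rsubmx).
  by rewrite row_mxKr linear0 => /rowP/(_ 0) /eqP; rewrite !mxE oner_eq0.
- case=> c c0.
  pose e : 'cV[rat]_(n + 1) := col_mx 0 1%:M.
  have pe (x : 'rV[rat]_n) : pairing e (lift x) = 1.
    by rewrite /pairing mul_row_col mulmx0 add0r mulmx1 mxE.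
  move=> hq; have : [set z | pairing e z = 1] (c^-1 *: lift q).
    apply: hull_sub hq; first exact: pairing_eq_convex.
    by move=> _ /= /mapP[x _ ->]; exact: pe.
  rewrite /= pairingZr pe mulr1 => /(congr1 GRing.inv); rewrite invrK invr1 => c1.
  move: hq; rewrite c1 invr1 scale1r => sq; case: nq.
  have sub : [set` map lift s] `<=` [set z | convex_hull [set` s] (lsubmx z)].
    by move=> _ /= /mapP[x xs ->]; rewrite row_mxKl; exact: sub_hull.
  suff : [set z | convex_hull [set` s] (lsubmx z)] (lift q).
    by rewrite /= row_mxKl.
  apply: hull_sub sq => //; apply/convex_setP => x y t /= xs ys t0 t1.
  rewrite linearP/= linearZ/=.
  exact: convex_comb (@hull_convex _ _) xs ys t0 t1.
have pu x : pairing u (lift x) = pairing (usubmx u) x + dsubmx u 0 0.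
  rewrite /pairing -[u in LHS]vsubmxK mul_row_col mxE; congr (_ + _).
  by rewrite mul1mx.
exists (usubmx u) => x xs; have := us _ (map_f lift xs).
by move: uq; rewrite !pu; lra.
Qed.

(** * Vertices of polytopes *)

(** An open half-space together with the one boundary point x is still convex, so x stays the strict
    maximizer of u on the hull. *)
Lemma exposed_vertex n (u : 'cV[rat]_n) (A : set 'rV[rat]_n) x :
  A x -> (forall y, A y -> y = x \/ pairing u y < pairing u x) ->
  vertices (convex_hull A) x.
Proof.
move=> Ax uA; pose B := [set y | y = x \/ pairing u y < pairing u x].
have cB : convex_set B.
  apply/convex_setP => y z t /= [->|yx] [->|zx] t0 t1.
  - by left; rewrite -scalerDl addrC subrK scale1r.
  - have [->|t1'] := eqVneq t 1.
      by left; rewrite subrr scale0r addr0 scale1r.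
    have : 0 < (1 - t) * (pairing u x - pairing u z).
      by rewrite mulr_gt0 // subr_gt0 // lt_neqAle t1'.
    by right; rewrite !pairingE; lra.
  - have [->|t0'] := eqVneq t 0.
      by left; rewrite scale0r add0r subr0 scale1r.
    have : 0 < t * (pairing u x - pairing u y).
      by rewrite mulr_gt0 // ?subr_gt0 // lt0r t0'.
    by right; rewrite !pairingE; lra.
  - by right; apply: convex_comb (@pairing_lt_convex _ u (pairing u x)) yx zx t0 t1.
have AB y : convex_hull A y -> B y by apply: hull_sub.
split=> [|y z t /AB By /AB Bz t0 t1 xE]; first exact: sub_hull.
have t1' : 0 < 1 - t by rewrite subr_gt0.
have := congr1 (pairing u) xE; rewrite !pairingE => {xE}.
case: By Bz => [->|yx] [->|zx] //.
- have : 0 < (1 - t) * (pairing u x - pairing u z) by rewrite mulr_gt0 // subr_gt0.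
  by move=> *; exfalso; lra.
- have : 0 < t * (pairing u x - pairing u y) by rewrite mulr_gt0 // subr_gt0.
  by move=> *; exfalso; lra.
- have : 0 < (1 - t) * (pairing u x - pairing u z) by rewrite mulr_gt0 // subr_gt0.
  have : 0 < t * (pairing u x - pairing u y) by rewrite mulr_gt0 // subr_gt0.
  by move=> *; exfalso; lra.
Qed.

(** Generators lying in the hull of the others are discarded one at a time; once none is left,
    separation exposes each remaining generator as a vertex. *)
Lemma polytope_vertices n (P : set 'rV[rat]_n) : polytope P ->
  exists2 s : seq 'rV[rat]_n, vertices P = [set` s] & P = convex_hull [set` s].
Proof.
case=> s; have [m] := ubnP (size s); elim: m s => // m IHm s /= sm Ps.
have [[x xs xh]|nh] := pselect (exists2 x, x \in s &
    convex_hull [set` [seq y <- s | y != x]] x).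
  apply: (IHm [seq y <- s | y != x]).
    rewrite size_filter -ltnS (leq_trans _ sm) // ltnS -(count_predC (pred1 x)).
    by rewrite -[X in (X < _)%N]add0n ltn_add2r -has_count has_pred1.
  rewrite Ps; apply/seteqP; split.
    apply: hull_sub (@hull_convex _ _) _ => y /= ys.
    have [->//|yx] := eqVneq y x; apply: sub_hull.
    by rewrite /= mem_filter /= yx.
  by apply: hull_mono => y /=; rewrite mem_filter => /andP[].
exists s => //; rewrite Ps; apply/seteqP; split; first exact: vertices_hull.
move=> x /= xs; have [u us] : exists u, forall y,
    y \in [seq y <- s | y != x] -> pairing u y < pairing u x.
  by apply: separation => xh; apply: nh; exists x.
apply: (@exposed_vertex _ u) => // y /= ys.
by have [->|yx] := eqVneq y x; [left|right; apply: us; rewrite mem_filter /= yx].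
Qed.

Lemma hull_vertices n (P : set 'rV[rat]_n) :
  polytope P -> P = convex_hull (vertices P).
Proof. by case/polytope_vertices => s ->. Qed.

(** * The origin as an interior point *)

Lemma interior0P n (P : set 'rV[rat]_n) :
  interior (P : set 'rV[rat^o]_n) 0 <->
  exists2 e : rat, 0 < e & forall x : 'rV[rat]_n, (forall i, `|x 0 i| < e) -> P x.
Proof.
rewrite /interior /=; split.
  case/nbhs_ballP => e /= e0 eP; exists e => // x xe; apply: eP; split=> // i j.
  by rewrite ord1 -ball_normE /ball_ /= mxE sub0r normrN.
case=> e e0 eP; apply/nbhs_ballP; exists e => //= x [_ xe]; apply: eP => i.
by have := xe 0 i; rewrite -ball_normE /ball_ /= mxE sub0r normrN.
Qed.

Lemma interior0_absorb n (P : set 'rV[rat]_n) (x : 'rV[rat]_n) :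
  interior (P : set 'rV[rat^o]_n) 0 -> exists2 c, 0 < c & P (c *: x).
Proof.
(* S bounds every coordinate of x; the summand 1 makes it positive and the bound strict. *)
case/interior0P => e e0 eP; pose S := 1 + \sum_i `|x 0 i|.
have S0 : 0 < S by rewrite ltr_wpDr // sumr_ge0.
exists (e / S); first exact: divr_gt0.
apply: eP => i; rewrite mxE normrM gtr0_norm ?divr_gt0 // mulrAC.
rewrite ltr_pdivrMr // ltr_pM2l // /S (bigD1 i) //= addrCA ltrDl.
by rewrite ltr_wpDr // sumr_ge0.
Qed.

(** Absorbing plus and minus each basis vector gives short segments on the axes, and convexity
    combines them into a cube around 0. *)
Lemma absorb_interior0 n (P : set 'rV[rat]_n) : convex_set P -> P 0 ->
  (forall x, exists2 c, 0 < c & P (c *: x)) ->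
  interior (P : set 'rV[rat^o]_n) 0.
Proof.
move=> /convex_setP cP P0 absP.
have seg x c d : P (d *: x) -> 0 <= c -> c <= d -> P (c *: x).
  move=> Px c0 cd; have [d0|d0] := eqVneq d 0.
    by have <- : d = c by lra.
  have dp : 0 < d by rewrite lt0r d0 (le_trans c0).
  have := cP _ _ (c / d) Px P0; rewrite scaler0 addr0 scalerA divfK //; apply.
    by rewrite divr_ge0 // ltW.
  by rewrite ler_pdivrMr // mul1r.
have axis i : exists2 d : rat, 0 < d &
    forall c : rat, `|c| < d -> P (c *: delta_mx 0 i).
  have [a a0 Pa] := absP (delta_mx 0 i).
  have [b b0 Pb] := absP (- delta_mx 0 i).
  exists (Num.min a b); first by rewrite lt_min a0.
  move=> c; rewrite lt_min => /andP[ca cb]; have [c0|c0] := lerP 0 c.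
    by apply: seg Pa _ _; rewrite // -(ger0_norm c0) ltW.
  have -> : c *: delta_mx 0 i = (- c) *: - delta_mx 0 i :> 'rV[rat]_n.
    by rewrite scalerN scaleNr opprK.
  by apply: seg Pb _ _; rewrite ?oppr_ge0 -?(ltr0_norm c0) // ltW.
(* Coordinates enter one at a time: each sum is the midpoint of twice the old sum and twice the new
   term, whence the halved radius. *)
suff [e e0 eP] : exists2 e, 0 < e & forall x : 'rV[rat]_n,
    (forall i, `|x 0 i| < e) -> P (\sum_(i <- enum 'I_n) x 0 i *: delta_mx 0 i).
  by apply/interior0P; exists e => // x /eP; rewrite big_enum /= -row_sum_delta.
elim: (enum 'I_n) => [|i s [e e0 eP]].
  by exists 1 => // x _; rewrite big_nil.
have [d d0 dP] := axis i.
exists (Num.min e d / 2); first by rewrite divr_gt0 // lt_min e0.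
move=> x xed; rewrite big_cons.
have x2 j : `|2 * x 0 j| < Num.min e d.
  by have := xed j; rewrite ltr_pdivlMr // normrM mulrC gtr0_norm.
have -> : x 0 i *: delta_mx 0 i + \sum_(j <- s) x 0 j *: delta_mx 0 j =
  2^-1 *: (\sum_(j <- s) (2 *: x) 0 j *: delta_mx 0 j)
  + (1 - 2^-1) *: ((2 * x 0 i) *: delta_mx 0 i) :> 'rV[rat]_n.
  rewrite scaler_sumr addrC; congr (_ + _); last first.
    by rewrite scalerA; congr (_ *: _); lra.
  apply: eq_bigr => j _; rewrite scalerA; congr (_ *: _).
  by rewrite mxE; lra.
apply: cP => //.
  apply: eP => j; rewrite mxE; apply: lt_le_trans (x2 j) _.
  by rewrite ge_min lexx.
apply: dP; apply: lt_le_trans (x2 i) _.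
by rewrite ge_min lexx orbT.
Qed.

(** By Farkas, every point lies in the cone of s, hence has a positive multiple in the hull. The
    implication sits inside the existential so that u = 0 still yields an element of s, which
    matters for n = 0. *)
Lemma interior_hull n (s : seq 'rV[rat]_n) :
  (forall u, exists2 x, x \in s & u != 0 -> 0 < pairing u x) ->
  interior (convex_hull [set` s] : set 'rV[rat^o]_n) 0.
Proof.
move=> pos.
have hull0 : convex_hull [set` s] 0.
  apply: contrapT => /separation[u us]; have [x xs ux] := pos u.
  have := us x xs; rewrite {2}/pairing mul0mx mxE; apply/negP; rewrite -leNgt.
  by have [->|/ux/ltW//] := eqVneq u 0; rewrite /pairing mulmx0 mxE.
apply: absorb_interior0 => // [|y]; first exact: hull_convex.
have [/in_cone_hull[->|[c c0 yc]]|[u us uy]] := farkas s y.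
- by exists 1; rewrite ?scaler0.
- by exists c^-1; rewrite ?invr_gt0.
have [x xs ux] := pos u; have := us x xs; rewrite leNgt ux //.
by apply: contraTneq uy => ->; rewrite /pairing mulmx0 mxE ltxx.
Qed.

Lemma interior_dim n (P : set 'rV[rat]_n) :
  interior (P : set 'rV[rat^o]_n) 0 -> has_dim P n.
Proof.
move=> P0; have P00 : P 0.
  by have [c _] := interior0_absorb 0 P0; rewrite scaler0.
split; first by exists 0.
exists fullv; split=> [x y _ _|U PU|]; first by rewrite memvf.
  apply/subvP => x _; have [c c0 Px] := interior0_absorb x P0.
  have := PU _ _ Px P00; rewrite subr0 => /(memvZ c^-1).
  by rewrite scalerA mulVf ?gt_eqF // scale1r.
by rewrite dimvf /dim /= mul1n.
Qed.

(** * Shears along a factor *)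

(** One relation for both directions: w takes P to the mutation, - w takes it back. A nonnegative
    height allows every point of F; a negative height guarantees only some point. *)
Definition shears_into n (w : 'cV[rat]_n) (A F Q : set 'rV[rat]_n) : Prop :=
  forall v, A v -> (exists2 f, F f & Q (v + pairing w v *: f)) /\
    (0 <= pairing w v -> forall f, F f -> Q (v + pairing w v *: f)).

Lemma polytope_max n (u : 'cV[rat]_n) (P : set 'rV[rat]_n) :
  polytope P -> P !=set0 ->
  exists2 x, vertices P x & forall y, P y -> pairing u y <= pairing u x.
Proof.
case/polytope_vertices => s -> -> [x /(hull_le u)[y /= ys _]].
have {y ys} [y ys ymax] : exists2 y, y \in s &
    forall z, z \in s -> pairing u z <= pairing u y.
  elim: s y ys => // x' s IHs _ _; case: s IHs => [_|z s /(_ z)[]].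
  - by exists x' => [|z]; rewrite inE => // /eqP ->.
  - exact: mem_head.
  move=> y ys ymax; have [xy|yx] := leP (pairing u x') (pairing u y).
    exists y => [|t]; first by rewrite inE ys orbT.
    by rewrite inE => /predU1P[->//|/ymax].
  exists x' => [|t]; first exact: mem_head.
  by rewrite inE => /predU1P[->//|/ymax /le_trans]; apply; exact: ltW.
exists y => // z /(hull_le u)[t /= ts zt]; exact: le_trans zt (ymax t ts).
Qed.

(** For fixed v, the points f with v + w(v) f in Q form a convex set. *)
Lemma shears_into_hull n (w : 'cV[rat]_n) (A V Q : set 'rV[rat]_n) :
  convex_set Q -> shears_into w A V Q -> shears_into w A (convex_hull V) Q.
Proof.
move=> cQ sh v /sh[[f Vf Qf] all]; split; first by exists f => //; exact: sub_hull.
move=> /all{}all.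
apply: (@hull_sub _ _ [set f | Q (v + pairing w v *: f)]) => //.
apply/convex_setP => x y t /= Qx Qy t0 t1.
have := convex_comb cQ Qx Qy t0 t1; congr Q.
by apply/rowP => i; rewrite !mxE; ring.
Qed.

(** With T(u) on the left, f1 gives equality at nonnegative heights; at negative heights the factor
    w(v) reverses u(f) <= u(f1), so any f will do. *)
Lemma shears_into_ge n (w u : 'cV[rat]_n) (A F Q : set 'rV[rat]_n) f1 v :
  shears_into w A F Q -> F f1 ->
  (forall f, F f -> pairing u f <= pairing u f1) -> A v ->
  exists f, [/\ F f, Q (v + pairing w v *: f) &
    pairing (u + pairing u f1 *: w) v <= pairing u (v + pairing w v *: f)].
Proof.
move=> sh Ff1 max /sh[[f Ff Qf] all]; have [w0|w0] := leP 0 (pairing w v).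
  by exists f1; split; [|exact: all|rewrite !pairingE mulrC].
exists f; split=> //; rewrite !pairingE lerD2l mulrC ler_nM2l //; exact: max.
Qed.

(** B may be infinite; the finite list s makes its hull a polytope whose vertices are sheared
    vertices of P. *)
Lemma shears_into_generators n (w : 'cV[rat]_n) (P F B : set 'rV[rat]_n) :
  polytope P -> polytope F -> F !=set0 -> (forall f, F f -> pairing w f = 0) ->
  shears_into w (vertices P) (vertices F) (convex_hull B) ->
  shears_into (- w) B F P ->
  exists2 s : seq 'rV[rat]_n, convex_hull B = convex_hull [set` s] &
    forall x, x \in s <-> convex_hull B x /\ exists v f,
      [/\ vertices P v, vertices F f & x = v + pairing w v *: f].
Proof.
move=> polP polF F0 wF shPQ shQP.
have [sP VP PE] := polytope_vertices polP.
have [sF VF FE] := polytope_vertices polF.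
pose T := [seq x <- [seq v + pairing w v *: f | v <- sP, f <- sF]
             | `[< convex_hull B x >]].
have TP x : x \in T <-> convex_hull B x /\ exists v f,
      [/\ vertices P v, vertices F f & x = v + pairing w v *: f].
  rewrite mem_filter VP VF; split.
    case/andP => /asboolP Bx /allpairsP[[v f] /= [vP fF xE]].
    by split=> //; exists v, f.
  case=> Bx [v [f [vP fF xE]]]; apply/andP; split; first exact/asboolP.
  by apply/allpairsP; exists (v, f).
exists T => //; apply/seteqP; split; last first.
  by apply: hull_sub (@hull_convex _ _) _ => x /= /TP[].
apply: hull_sub (@hull_convex _ _) _ => q Bq; apply: contrapT => /separation[u uT].
have [f1 Vf1 max] := polytope_max u polF F0.
have Ff1 : F f1 by case: Vf1.
pose u' := u + pairing u f1 *: w.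
have u'F f : F f -> pairing u' f = pairing u f.
  by move=> Ff; rewrite !pairingE wF // mulr0 addr0.
(* Shear q back with - w. As w vanishes on F, f1 also maximizes u', and u' - u'(f1) w is again u. *)
have [f [Ff Pp]] : exists f, [/\ F f, P (q + pairing (- w) q *: f) &
    pairing (u' + pairing u' f1 *: - w) q <= pairing u' (q + pairing (- w) q *: f)].
  apply: (shears_into_ge shQP Ff1 _ Bq) => f Ff.
  by rewrite !u'F //; exact: max.
rewrite u'F // scalerN addrK => uq.
have [v Vv uv] : exists2 v, vertices P v &
    pairing u' (q + pairing (- w) q *: f) <= pairing u' v.
  by rewrite VP; apply: hull_le; rewrite -PE.
(* Shear v forward: u(q) <= u'(v) <= u at a point of T, against the choice of u. *)
have [g [Vg Bg ug]] := shears_into_ge shPQ Vf1 (fun g Vg => max g (proj1 Vg)) Vv.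
have /uT : v + pairing w v *: g \in T by apply/TP; split=> //; exists v, g.
by apply/negP; rewrite -leNgt (le_trans uq) // (le_trans uv).
Qed.

Lemma shears_into_interior n (w : 'cV[rat]_n) (P F B : set 'rV[rat]_n) :
  polytope P -> polytope F -> F !=set0 -> (forall f, F f -> pairing w f = 0) ->
  shears_into w (vertices P) (vertices F) (convex_hull B) ->
  shears_into (- w) B F P ->
  interior (P : set 'rV[rat^o]_n) 0 ->
  interior (convex_hull B : set 'rV[rat^o]_n) 0.
Proof.
move=> polP polF F0 wF shPQ shQP P0.
have [s BE sE] := shears_into_generators polP polF F0 wF shPQ shQP.
rewrite BE; apply: interior_hull => u.
have [f1 Vf1 max] := polytope_max u polF F0.
pose u' := u + pairing u f1 *: w.
(* Unless u' = 0, it is positive at its own transpose; a positive multiple of that point lies in P,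
   so u' is positive at some vertex v. *)
have [c c0] := interior0_absorb u'^T P0.
have [sP VP ->] := polytope_vertices polP; rewrite -VP => /(hull_le u')[v Vv uv].
have [g [Vg Bg ug]] := shears_into_ge shPQ Vf1 (fun g Vg => max g (proj1 Vg)) Vv.
exists (v + pairing w v *: g); first by apply/sE; split=> //; exists v, g.
move=> u0; have : u' != 0.
  (* If u' = 0 then u = - u(f1) w, which vanishes at f1; so the coefficient u(f1) is 0 and u = 0. *)
  apply: contra u0 => /eqP u'0; have uE : u = - (pairing u f1 *: w).
    by apply/eqP; rewrite -addr_eq0 -/u' u'0.
  have uf1 : pairing u f1 = 0.
    by rewrite uE pairingNl pairingZl wF ?mulr0 ?oppr0 //; case: Vf1.
  by rewrite uE uf1 scale0r oppr0.
move=> /pairing_tr_gt0 u'0; apply: lt_le_trans ug; apply: lt_le_trans uv.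
by rewrite pairingZr mulr_gt0.
Qed.

(** * Lattice points and the Fano property *)

Lemma embed_shear n (w : 'cV[int]_n) (z g : 'rV[int]_n) :
  embed z + pairing (map_mx intr w) (embed z) *: embed g =
  embed (z + (z *m w) 0 0 *: g).
Proof.
by rewrite /pairing /embed -map_mxM mxE -map_mxZ -map_mxD.
Qed.

(** As w(g) = 0, the shear is additive with inverse u |-> u - w(u) g, so divisors of the image pull
    back to divisors of z. *)
Lemma primitive_shear n (w : 'cV[int]_n) (z g : 'rV[int]_n) :
  (g *m w) 0 0 = 0 -> primitive z -> primitive (z + (z *m w) 0 0 *: g).
Proof.
move=> gw zp u k uE; apply: (zp (u - (u *m w) 0 0 *: g)).
have zw : (z *m w) 0 0 = (u *m w) 0 0 *+ k.
  have := congr1 (fun x : 'rV_n => (x *m w) 0 0) uE.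
  rewrite mulmxDl -scalemxAl -scaler_nat -scalemxAl.
  by rewrite [LHS]mxE [X in _ + X]mxE gw mulr0 addr0 [RHS]mxE mulr_natl.
by rewrite mulrnBl scalerMnl -zw -uE addrK.
Qed.

(** B is arbitrary because it will be the generators of the mutation in one direction and the
    vertices of P in the other. *)
Lemma fano_shears_into n (w : 'cV[int]_n) (P F B : set 'rV[rat]_n) :
  fano P -> lattice_polytope F -> F !=set0 -> F `<=` hyperplane w 0 ->
  shears_into (map_mx intr w) (vertices P) (vertices F) (convex_hull B) ->
  shears_into (- map_mx intr w) B F P ->
  fano (convex_hull B).
Proof.
move=> [[polP _] _ P0 primP] [polF latF] F0 wF shPQ shQP.
have {}wF f : F f -> pairing (map_mx intr w) f = 0 by move/wF.
have [s BE sE] := shears_into_generators polP polF F0 wF shPQ shQP.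
have Q0 := shears_into_interior polP polF F0 wF shPQ shQP P0.
have prim : vertices (convex_hull B) `<=` @primitive_point n.
  move=> x; rewrite BE => /vertices_hull /= /sE[_ [v [f [Vv Vf ->]]]].
  have [z -> zp] := primP _ Vv; have := wF f (proj1 Vf).
  have [g _ <-] := latF _ Vf => gw.
  exists (z + (z *m w) 0 0 *: g); first exact: embed_shear.
  apply: primitive_shear => //; apply: (@intr_inj rat).
  by rewrite mulr0z -gw /pairing /embed -map_mxM [RHS]mxE.
split=> //; last exact: interior_dim.
split; first by exists s.
by move=> x /prim[z ->]; exists z.
Qed.

(** * Heights and slices *)

Lemma hmin_le n (w : 'cV[int]_n) (P : set 'rV[rat]_n) x :
  polytope P -> P x -> hmin w P <= height w x.
Proof.
move=> polP Px.
have [v [Pv _] vmax] := polytope_max (- map_mx intr w) polP (ex_intro _ x Px).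
(* v minimizes w on P, so [xget] does not fall back on its default 0. *)
rewrite /hmin; case: xgetP => [m _ [_ lb]|/(_ (height w v)) []].
  by apply: lb; exists x.
split; first by exists v.
by move=> _ [y Py <-]; have := vmax y Py; rewrite !pairingNl lerN2.
Qed.

Lemma le_hmax n (w : 'cV[int]_n) (P : set 'rV[rat]_n) x :
  polytope P -> P x -> height w x <= hmax w P.
Proof.
move=> polP Px.
have [v [Pv _] vmax] := polytope_max (map_mx intr w) polP (ex_intro _ x Px).
rewrite /hmax; case: xgetP => [m _ [_ ub]|/(_ (height w v)) []].
  by apply: ub; exists x.
split; first by exists v.
by move=> _ [y Py <-]; exact: vmax.
Qed.

Lemma height_embed n (w : 'cV[int]_n) z : height w (embed z) = ((z *m w) 0 0)%:~R.
Proof. by rewrite /height /embed -map_mxM mxE. Qed.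

Lemma polytope_convex n (P : set 'rV[rat]_n) : polytope P -> convex_set P.
Proof. by case=> s ->; exact: hull_convex. Qed.

Lemma slice_sub n (w : 'cV[int]_n) (P : set 'rV[rat]_n) h :
  convex_set P -> slice w P h `<=` P.
Proof. by move=> cP; apply: hull_sub => // x [[]]. Qed.

Lemma slice_height n (w : 'cV[int]_n) (P : set 'rV[rat]_n) h x :
  slice w P h x -> height w x = h%:~R.
Proof.
apply: (@hull_sub _ _ (hyperplane w h)) => [|y [[]]//].
exact: (@pairing_eq_convex _ (map_mx intr w)).
Qed.

(** The map f |-> g + c f is affine and injective and sends F into P, so a segment through f would
    give one through the vertex. *)
Lemma vertices_minkowski n (P F : set 'rV[rat]_n) g c f : c != 0 ->
  F f -> (forall f', F f' -> P (g + c *: f')) -> vertices P (g + c *: f) ->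
  vertices F f.
Proof.
move=> c0 Ff gP [_ ext]; split=> // x y t Fx Fy t0 t1 fE.
have inj z : g + c *: z = g + c *: f -> z = f.
  by move/addrI/(scalerI c0).
have [|/inj-> /inj->//] := ext _ _ t (gP _ Fx) (gP _ Fy) t0 t1.
by rewrite fE; apply/rowP => i; rewrite !mxE; ring.
Qed.

(** * The mutation as a shear, and its reversal *)

Definition mutation_generators n (w : 'cV[int]_n) (P F : set 'rV[rat]_n)
    (G : int -> set 'rV[rat]_n) : set 'rV[rat]_n :=
  \bigcup_(h in [set h : int | hmin w P <= h%:~R /\ h < 0]) G h
  `|` \bigcup_(h in [set h : int | 0 <= h /\ h%:~R <= hmax w P])
        minkowski_sum (slice w P h) (dilate h F).

(** Each generator is sheared back into P. The last conjunct keeps a whole translate of h F among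
    the generators, which later makes f a vertex of F when q is a vertex of the mutation at nonzero
    height. *)
Lemma mutation_generatorsP n (w : 'cV[int]_n) (P F : set 'rV[rat]_n)
    (G : int -> set 'rV[rat]_n) q :
  convex_set P -> F !=set0 -> F `<=` hyperplane w 0 -> mutation_data w P F G ->
  mutation_generators w P F G q ->
  (height w q < 0 /\ forall f, F f -> P (q - height w q *: f)) \/
  (0 <= height w q /\ exists2 f, F f & P (q - height w q *: f) /\
     forall f', F f' ->
       mutation_generators w P F G (q - height w q *: f + height w q *: f')).
Proof.
move=> cP [f0 Ff0] wF Gd [[h [hm h0] Gq]|[h [h0 hm] [p Pp [_ [f Ff <-] <-]]]].
- have [_ _ GP] := Gd h hm h0.
  have slq f : F f -> slice w P h (q - h%:~R *: f).
    move=> Ff; apply: GP; exists q => //; exists ((- h)%:~R *: f); first by exists f.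
    by rewrite mulrNz scaleNr.
  (* Nothing places [G h] at height h directly; the height is read off the slice point q - h f0,
     because w vanishes at f0. *)
  have wq : height w q = h%:~R.
    have := slice_height (slq _ Ff0).
    rewrite [height _ _](pairingDr (map_mx intr w)) pairingNr pairingZr.
    by rewrite [pairing _ f0](wF _ Ff0) mulr0z mulr0 subr0.
  left; rewrite wq; split; first by rewrite ltrz0.
  by move=> f /slq /(slice_sub cP).
- right; have wq : height w (p + h%:~R *: f) = h%:~R.
    rewrite [height _ _](pairingDr (map_mx intr w)) pairingZr.
    by rewrite [pairing _ f](wF _ Ff) mulr0z mulr0 addr0; exact: slice_height Pp.
  rewrite wq ler0z; split=> //; exists f => //; rewrite addrK; split.
    exact: slice_sub Pp.
  move=> f' Ff'; right; exists h => //; exists p => //.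
  by exists (h%:~R *: f') => //; exists f'.
Qed.

Lemma vertices_shears_into_mutation n (w : 'cV[int]_n) (P F : set 'rV[rat]_n)
    (G : int -> set 'rV[rat]_n) :
  lattice_polytope P -> polytope F -> F !=set0 -> mutation_data w P F G ->
  shears_into (map_mx intr w) (vertices P) (vertices F) (mutation w P F G).
Proof.
move=> [polP latP] polF F0 Gd v Vv; have [z _ zv] := latP _ Vv.
pose h := (z *m w) 0 0; have wv : height w v = h%:~R by rewrite -zv height_embed.
have hm := hmin_le w polP (proj1 Vv); have hM := le_hmax w polP (proj1 Vv).
rewrite -[pairing _ v]/(height w v) wv in hm hM *.
have up f : 0 <= h -> vertices F f -> mutation w P F G (v + h%:~R *: f).
  move=> h0 [Ff _]; apply: sub_hull; right; exists h => //; exists v.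
    by apply: sub_hull; split; [split=> //; exact: Vv.1|exists z].
  by exists (h%:~R *: f) => //; exists f.
have [h0|h0] := leP 0 h.
  split=> [|_ f]; last exact: up.
  (* The zero functional merely picks some vertex of F. *)
  by have [f Vf _] := polytope_max 0 polF F0; exists f => //; exact: up.
split; last by rewrite ler0z leNgt h0.
(* v = g - h f with g in [G h], so the shear returns g; f is a vertex of F because v is one of P and
   g - h F lies in P. *)
have [_ /(_ v (conj wv Vv))[g Gg [_ [f Ff <-] vE]] GP] := Gd h hm h0.
exists f.
  apply: (@vertices_minkowski _ P F g (- h)%:~R) => //; last by rewrite vE.
    by rewrite intr_eq0 oppr_eq0 lt_eqF.
  move=> f' Ff'; apply: (slice_sub (w := w) (h := h)); first exact: polytope_convex.
  by apply: GP; exists g => //; exists ((- h)%:~R *: f') => //; exists f'.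
rewrite -vE -addrA -scalerDl mulrNz addNr scale0r addr0.
by apply: sub_hull; left; exists h.
Qed.

Lemma mutation_generators_shears_into n (w : 'cV[int]_n) (P F : set 'rV[rat]_n)
    (G : int -> set 'rV[rat]_n) :
  convex_set P -> F !=set0 -> F `<=` hyperplane w 0 -> mutation_data w P F G ->
  shears_into (- map_mx intr w) (mutation_generators w P F G) F P.
Proof.
move=> cP F0 wF Gd q Bq; rewrite pairingNl -[pairing _ q]/(height w q).
rewrite oppr_ge0.
have [[w0 all]|[w0 [f Ff [Pf _]]]] := mutation_generatorsP cP F0 wF Gd Bq.
  have [f Ff] := F0; split=> [|_ g /all]; last by rewrite scaleNr.
  by exists f; rewrite // scaleNr; exact: all.
split; first by exists f; rewrite // scaleNr.
move=> w0'; have wq : height w q = 0 by apply/le_anti; rewrite w0'.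
by move=> g _; move: Pf; rewrite wq oppr0 !scale0r subr0 addr0.
Qed.

(** Restricting to vertices of the mutation lets f be a vertex of F, as [shears_into_generators]
    requires of the polytope it starts from. *)
Lemma mutation_vertices_shears_into n (w : 'cV[int]_n) (P F : set 'rV[rat]_n)
    (G : int -> set 'rV[rat]_n) :
  convex_set P -> polytope F -> F !=set0 -> F `<=` hyperplane w 0 ->
  mutation_data w P F G ->
  shears_into (- map_mx intr w) (vertices (mutation w P F G)) (vertices F) P.
Proof.
move=> cP polF F0 wF Gd q Vq; have Bq := vertices_hull Vq.
have [f0 Vf0 _] := polytope_max 0 polF F0.
rewrite pairingNl -[pairing _ q]/(height w q) oppr_ge0.
have [[w0 all]|[w0 [f Ff [Pf gen]]]] := mutation_generatorsP cP F0 wF Gd Bq.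
  split; first by exists f0; rewrite // scaleNr; apply: all Vf0.1.
  by move=> _ g [Fg _]; rewrite scaleNr; exact: all.
have [wq|wq] := eqVneq (height w q) 0.
  have Pq : P q by move: Pf; rewrite wq scale0r subr0.
  by rewrite wq oppr0; split=> [|_ g _]; [exists f0 => //|]; rewrite scale0r addr0.
split; last by rewrite leNgt lt0r wq w0.
exists f; last by rewrite scaleNr.
apply: (@vertices_minkowski _ (mutation w P F G) F (q - height w q *: f) _ f wq) => //.
  by move=> f' /gen; exact: sub_hull.
by rewrite subrK.
Qed.

Theorem proposition2 (n : nat) (w : 'cV[int]_n) (P F : set 'rV[rat]_n)
    (G : int -> set 'rV[rat]_n)
    (w_primitive : primitive w)
    (P_lattice : lattice_polytope P)
    (F_factor : is_factor w P F)
    (G_data : mutation_data w P F G) :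
  fano (mutation w P F G) <-> fano P.
Proof.
have [[polF latF] F0 wF _] := F_factor.
have [polP latP] := P_lattice; have cP := polytope_convex polP.
have shPQ := vertices_shears_into_mutation P_lattice polF F0 G_data.
split=> [fanoQ|fanoP]; last first.
  apply: fano_shears_into shPQ _ => //.
  exact: mutation_generators_shears_into.
have wN : map_mx intr (- w) = - map_mx intr w :> 'cV[rat]_n by exact: map_mxN.
(* For the converse, P and the mutation exchange roles, with - w in place of w and the vertices of P
   as B. *)
have PE := hull_vertices polP; rewrite PE.
apply: (@fano_shears_into _ (- w) _ F _ fanoQ) => //.
- move=> f /wF wf; rewrite /hyperplane /=.
  rewrite -[height _ f]/(pairing (map_mx intr (- w)) f) wN pairingNl.
  by rewrite [pairing _ f]wf oppr0.
- by rewrite wN -PE; exact: mutation_vertices_shears_into.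
(* The way back to the mutation must allow all of F, which is the hull of its vertices. *)
rewrite wN opprK [X in shears_into _ _ X](hull_vertices polF).
by apply: shears_into_hull shPQ; exact: hull_convex.
Qed.
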